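(* Let $\mathbb T=\mathbb R/\mathbb Z$ be the circle group. The compact topological group $X=\mathbb T\times\mathbb T$ contains a sequence $(x_n)_{n=1}^\infty$ such that: (1) $(x_n)_{n=1}^\infty$ converges to zero in $X$; (2) for every continuous homomorphism $f:X\to\mathbb T$ the series $\sum_{n=1}^\infty f(x_n)$ is potentially convergent in $\mathbb T$; (3) the series $\sum_{n=1}^\infty x_n$ is not potentially convergent in $X$.
   Context: A series $\sum_{n=1}^\infty y_n$ in an Abelian topological group $Y$ (written additively) is potentially convergent in $Y$ if there exist a permutation $\sigma$ of $\mathbb N=\{1,2,\dots\}$ and a point $y\in Y$ such that the sequence of partial sums $\big(\sum_{n=1}^m y_{\sigma(n)}\big)_{m=1}^\infty$ converges to $y$. In (2) the permutation may depend on $f$. The groups $\mathbb T$ and $\mathbb T\times\mathbb T$ carry the quotient topology and the product topology, respectively. *)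

(* Defs.v *)
From HB Require Import structures.
From mathcomp Require Import all_boot all_order all_algebra.
From mathcomp Require Import all_classical all_reals all_analysis.

Set Implicit Arguments.
Unset Strict Implicit.
Unset Printing Implicit Defensive.

Import Order.TTheory GRing.Theory Num.Theory.
Import numFieldNormedType.Exports.

Local Open Scope classical_set_scope.
Local Open Scope ring_scope.
Local Open Scope quotient_scope.

Definition integers (R : realType) : pred R := fun x => x \is a Num.int.
Arguments integers : clear implicits.

Fact integers_zmod_closed (R : realType) : zmod_closed (integers R).
Proof.
by split=> [|x y xZ yZ]; rewrite unfold_in; [exact: rpred0 | exact: rpredB].
Qed.

HB.instance Definition _ (R : realType) :=
  GRing.isZmodClosed.Build R (integers R) (integers_zmod_closed R).

Definition integers_group (R : realType) : zmodClosed R :=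
  GRing.ZmodClosed.clone R (integers R) _.

(* [Quotient.quot] is the quotient of an additive group by a subgroup,
   [quotient_topology] the finest topology making the projection continuous. *)
Definition circle (R : realType) : Type :=
  quotient_topology (Quotient.quot (integers_group R)).

Section circle.
Variable R : realType.
Implicit Types x y : R.

HB.instance Definition _ := Topological.on (circle R).
HB.instance Definition _ := Quotient.on (circle R).
(* [quotient_topology] and [Quotient.quot] carry distinct (extensionally equal)
   boolean equalities, so that the group structure of the latter cannot simply be
   copied; its operations are the ones used here. *)
HB.instance Definition _ := GRing.isZmodule.Build (circle R)
  (@Quotient.addqA R (integers_group R)) (@Quotient.addqC R (integers_group R))
  (@Quotient.add0q R (integers_group R)) (@Quotient.addNq R (integers_group R)).

Let p : R -> circle R := \pi_(circle R).

Let p_continuous : continuous p.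
Proof. exact: (@pi_continuous R (Quotient.quot (integers_group R))). Qed.

Let pB x y : p (x - y) = p x - p y.
Proof.
exact: (@pi_is_zmod_morphism R _ _ (Quotient.quot (integers_group R))).
Qed.

Let p_eq x y : p x = p y <-> x - y \is a Num.int.
Proof.
rewrite [_ \is a _](Quotient.idealrBE (integers_group R) x y).
by split=> [pxy|/eqP]; [apply/eqP; exact: pxy | exact].
Qed.

Let p_repr (a : circle R) : p (repr a) = a.
Proof. exact: reprK. Qed.

Let p_nbhs x (A : set R) : nbhs x A -> nbhs (p x) (p @` A).
Proof.
rewrite nbhsE => -[B [Bo Bx] BA].
rewrite nbhsE; exists (p @` B); last exact: image_subset.
split; last by exists x.
suff : open (p @^-1` (p @` B)) by [].
rewrite openE => y [z Bz /p_eq zyZ]; change (nbhs y (p @^-1` (p @` B))).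
have tz : (fun t : R => t + (z - y)) @ y --> z.
  rewrite -{2}(subrKC y z); apply: cvgD; [exact: cvg_id | exact: cvg_cst].
have yB : \forall t \near y, B (t + (z - y)).
  exact: (tz B (open_nbhs_nbhs (conj Bo Bz))).
apply: (filterS _ yB) => t Bt; exists (t + (z - y)) => //.
by apply/p_eq; rewrite addrAC subrr add0r.
Qed.

Fact circle_sub_continuous :
  continuous (fun u : circle R * circle R => u.1 - u.2).
Proof.
move=> [a b] U /=; rewrite -[a]p_repr -[b]p_repr -pB => /p_continuous.
move=> /(@sub_continuous R (repr a, repr b)) [[A B] /= [nA nB] AB].
exists (p @` A, p @` B); first by split; exact: p_nbhs.
move=> [_ _] [/= [x Ax <-] [y By <-]].
by rewrite -pB; exact: (AB (x, y) (conj Ax By)).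
Qed.

HB.instance Definition _ :=
  PreTopologicalNmodule_isTopologicalZmodule.Build (circle R)
    circle_sub_continuous.

Lemma circle_compact : compact [set: circle R].
Proof.
have -> : [set: circle R] = p @` `[0, 1].
  apply/seteqP; split=> // a _; exists (repr a - (Num.floor (repr a))%:~R).
    rewrite /= in_itv /= subr_ge0 floor_le/= lerBlDl.
    by have := floorD1_gt (repr a); rewrite intrD => /ltW.
  rewrite -[RHS]p_repr; apply/p_eq.
  by rewrite addrAC subrr add0r rpredN intr_int.
apply: continuous_compact; last exact: segment_compact.
exact: continuous_subspaceT.
Qed.

End circle.

(* An alias of the product type, so that it can be given its own canonical
   structures: addition and topology are those of the product. *)
Definition torus (R : realType) : Type := (circle R * circle R)%type.

Section torus.
Variable R : realType.

HB.instance Definition _ := Topological.on (torus R).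
HB.instance Definition _ := GRing.Zmodule.on (torus R).

Fact torus_sub_continuous :
  continuous (fun u : torus R * torus R => u.1 - u.2).
Proof.
move=> [[a1 a2] [b1 b2]] U [[A B] /= [nA nB] AB].
have [/= [A1 B1] [nA1 nB1] AB1] := @sub_continuous (circle R) (a1, b1) _ nA.
have [/= [A2 B2] [nA2 nB2] AB2] := @sub_continuous (circle R) (a2, b2) _ nB.
exists (A1 `*` A2, B1 `*` B2).
  by split; [exists (A1, A2)|exists (B1, B2)].
move=> [[x1 x2] [y1 y2]] [/= [Ax1 Ax2] [By1 By2]].
by apply: AB; split; [exact: (AB1 (x1, y1))|exact: (AB2 (x2, y2))].
Qed.

HB.instance Definition _ :=
  PreTopologicalNmodule_isTopologicalZmodule.Build (torus R)
    torus_sub_continuous.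

Lemma torus_compact : compact [set: torus R].
Proof.
by rewrite -setXTT; apply: compact_setX; exact: circle_compact.
Qed.

End torus.

(* Sequences are indexed from 0, so that [y n] is the term of rank n + 1, and
   [series y m] is the partial sum y 0 + ... + y (m - 1). *)
Definition potentially_convergent (Y : topologicalZmodType) (y : nat -> Y) :=
  exists (s : nat -> nat) (l : Y),
    bijective s /\ series (y \o s) @ \oo --> l.

(* Main.v *)
From HB Require Import structures.
Require Import Defs.
From mathcomp Require Import all_boot all_order all_algebra.
From mathcomp Require Import all_classical all_reals all_analysis.
From mathcomp Require Import lra ring zify.

Import Order.TTheory GRing.Theory Num.Theory.
Import numFieldNormedType.Exports.

Local Open Scope classical_set_scope.
Local Open Scope ring_scope.

(** A sequence of the torus tending to zero lifts to a sequence of vectors of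
    the plane tending to zero, and whether a rearrangement of its series
    converges can be read on the lift.  No rearrangement converges as soon as
    some linear form maps the vectors to positive numbers with an infinite sum.
    The characters of the torus only test the forms with integer coefficients
    ([torus_char]), so that it is enough to create this obstruction along a
    single form of irrational slope.

    Fix [theta] irrational, let [t n] be a positive sequence tending to 0 whose
    sum is infinite, and take
      [v n = (a n, theta * a n + t n)] with [a n = +- sqrt (t n)],
    the signs alternating.  The form [(u, w) |-> w - theta * u] maps [v n] to
    [t n], so no rearrangement of the series of [v] has bounded partial sums,
    whereas the convergence of a rearrangement in the torus would bound those of
    both coordinates ([series_bounded_of_cvg_mod1]).  The form
    [(u, w) |-> k * u + l * w] maps [v n] to [c * a n + l * t n], where
    [c = k + l * theta] is nonzero unless [k = l = 0].  As [t n] is negligible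
    with respect to [sqrt (t n)], the sign of this term is eventually that of
    [c * a n], and it is at least a multiple of [t n] in absolute value: its
    positive and negative terms both have an infinite sum, and Riemann's greedy
    rearrangement ([greedy_cvg]) converges. *)

(** * The projection of the line onto the circle *)

Section mod1.
Local Open Scope quotient_scope.
Context {R : realType}.

Definition mod1 : R -> circle R := \pi_(circle R).

Lemma mod1_continuous : continuous mod1.
Proof. exact: (@pi_continuous R (Quotient.quot (integers_group R))). Qed.

Fact mod1_is_zmod_morphism : zmod_morphism mod1.
Proof.
exact: (@pi_is_zmod_morphism R _ _ (Quotient.quot (integers_group R))).
Qed.

HB.instance Definition _ :=
  GRing.isZmodMorphism.Build R (circle R) mod1 mod1_is_zmod_morphism.

Lemma mod1_surj (a : circle R) : exists x, mod1 x = a.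
Proof. by exists (repr a); exact: reprK. Qed.

Lemma mod1_eq x y : mod1 x = mod1 y <-> x - y \is a Num.int.
Proof.
rewrite [_ \is a _](Quotient.idealrBE (integers_group R) x y).
by split=> [xy|/eqP]; [apply/eqP; exact: xy|exact].
Qed.

(** The projection is an open map. *)
Lemma near_mod1 (c e : R) : 0 < e ->
  \forall a \near mod1 c, exists2 x, `|x - c| < e & mod1 x = a.
Proof.
move=> e0; rewrite /prop_near1 nbhsE.
exists (mod1 @` ball c e); last first.
  by move=> _ [x + <-]; rewrite /ball /= distrC; exists x.
split; last by exists c => //; exact: ballxx.
suff : open (mod1 @^-1` (mod1 @` ball c e)) by [].
have -> : mod1 @^-1` (mod1 @` ball c e) =
    \bigcup_(z in [set: int]) ball (c + z%:~R) e.
  apply/seteqP; split=> [y [x cx /mod1_eq]|y [z _]].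
    move=> /intrP[z xyz]; exists (- z) => //; move: cx.
    rewrite /ball /= rmorphN /= -xyz; congr (`|_| < e); ring.
  rewrite /ball /= => cy; exists (y - z%:~R).
    by rewrite /ball /= -[X in `|X|](_ : c + z%:~R - y = _)//; ring.
  by apply/mod1_eq; rewrite addrAC subrr add0r rpredN intr_int.
by apply: bigcup_open => z _; exact: ball_open.
Qed.

End mod1.

Lemma int_small {R : realType} (x : R) : x \is a Num.int -> `|x| < 1 -> x = 0.
Proof.
move=> /intrP[z ->]; rewrite -intr_norm ltrz1 => h.
by have -> : z = 0 by lia.
Qed.

(** * Continuous characters of the circle and of the torus *)

(** Dividing [t] by [d / n] leaves a remainder [s] with [n * s <= d], at which
    the deviation of [h] from the linear map is the same as at [t].  Hence [n]
    times the deviation at [t] is the deviation at [n * s], which is at most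
    [2 * M] for every [n]. *)
Lemma locally_additive_linear {R : realType} (h : R -> R) (d M : R) :
  0 < d -> (forall t, 0 <= t <= d -> `|h t| <= M) ->
  (forall s t, 0 <= s -> 0 <= t -> s + t <= d -> h (s + t) = h s + h t) ->
  forall t, 0 <= t <= d -> h t = h d / d * t.
Proof.
move=> d0 hM hD.
have hn n t : 0 <= t -> n%:R * t <= d -> h (n%:R * t) = n%:R * h t.
  move=> t0; elim: n => [|n IH] nd.
    have := hD 0 0 (lexx _) (lexx _); rewrite addr0 => /(_ (ltW d0)) h00.
    by rewrite !mul0r; lra.
  move: nd; rewrite -natr1 !mulrDl !mul1r => nd.
  have nt0 : 0 <= n%:R * t by rewrite mulr_ge0.
  by rewrite hD// IH//; lra.
move=> t /andP[t0 td].
apply/eqP; rewrite -subr_eq0 -normr_le0; apply/ler_addgt0Pl => e e0.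
rewrite addr0.
set K := `|h t - _|.
have M0 : 0 <= M by apply: le_trans (hM 0 _); rewrite ?lexx ?(ltW d0).
suff nK n : (0 < n)%N -> n%:R * K <= 2 * M.
  rewrite leNgt; apply/negP => eK.
  pose n := (Num.truncn (2 * M / e)).+1.
  have nn : 2 * M / e < n%:R by exact: truncnS_gt.
  have := nK n isT; rewrite leNgt => /negP; apply.
  rewrite ltr_pdivrMr// in nn; apply: (lt_trans nn).
  by rewrite ltr_pM2l// ltr0n.
move=> n0.
have nR : (0 : R) < n%:R by rewrite ltr0n.
pose q := d / n%:R; have q0 : 0 < q by rewrite divr_gt0.
have nq : n%:R * q = d by rewrite /q mulrCA divff ?mulr1// gt_eqF.
pose k := Num.truncn (t / q).
have kq : k%:R * q <= t.
  by rewrite -ler_pdivlMr// truncn_le divr_ge0// ltW.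
have kq1 : t < k%:R * q + q.
  by rewrite -[X in _ + X]mul1r -mulrDl natr1 -ltr_pdivrMr// truncnS_gt.
pose s := t - k%:R * q.
have k0 : (0 : R) <= k%:R * q by rewrite mulr_ge0// ltW.
have ts : t = k%:R * q + s by rewrite /s; ring.
have s0 : 0 <= s by rewrite /s; lra.
have nsd : n%:R * s <= d by rewrite -nq ler_pM2l// /s; lra.
have hdn : h d = n%:R * h q by rewrite -nq hn ?nq// ltW.
have Ks : n%:R * K = `|h (n%:R * s) - h d / d * (n%:R * s)|.
  rewrite hn// /K -[n%:R in LHS]ger0_norm 1?ltW// -normrM; congr `|_|.
  rewrite {1}ts hD//; last by rewrite -ts.
  rewrite hn//; [|exact: ltW|lra].
  rewrite ts hdn -nq; field.
  by rewrite !gt_eqF.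
rewrite Ks.
have ns0 : 0 <= n%:R * s by rewrite mulr_ge0.
have A : `|h (n%:R * s)| <= M by apply: hM; rewrite nsd ns0.
have B : `|h d / d * (n%:R * s)| <= M.
  rewrite mulrAC normrM normrV ?unitfE ?gt_eqF// normrM (ger0_norm (ltW d0)).
  rewrite (ger0_norm ns0).
  rewrite ler_pdivrMr//; apply: ler_pM => //.
  by apply: hM; rewrite lexx ltW.
apply: (le_trans (ler_normB _ _)); lra.
Qed.

(** Near 0 the values of [phi] have a unique lift [h] of absolute value less
    than 1/4, which is additive because the defect [h (s + t) - h s - h t] is an
    integer of absolute value less than 3/4.  So [h] is linear, and the formula
    extends from a neighborhood of 0 to the line by additivity. *)
Lemma real_char {R : realType} (phi : R -> circle R) :
  {morph phi : s t / s + t} -> phi @ 0 --> (0 : circle R) ->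
  exists c, forall t, phi t = mod1 (c * t).
Proof.
move=> phiD phi0.
have e0 : (0 : R) < 4^-1 by lra.
have p00 : phi 0 = 0 by apply: (@addrI _ (phi 0)); rewrite -phiD !addr0.
have := near_mod1 0 _ e0; rewrite raddf0 => /phi0 /nbhs_ballP[d /= d0 Hd].
have lift t : `|t| < d -> {y | `|y| < 4^-1 & mod1 y = phi t}.
  move=> td; apply: cid2; have := Hd t; rewrite /ball /= sub0r normrN.
  move=> /(_ td)[y].
  by rewrite subr0; exists y.
pose h t := if pselect (`|t| < d) is left p then s2val (lift t p) else 0.
have hs t : `|t| < d -> `|h t| < 4^-1.
  by rewrite /h; case: pselect => // p _; case: (lift t p).
have hp t : `|t| < d -> mod1 (h t) = phi t.
  by rewrite /h; case: pselect => // p _; case: (lift t p).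
pose d2 := d / 2.
have d20 : 0 < d2 by rewrite /d2; lra.
have dd : d2 < d by rewrite /d2; lra.
have hlin t : 0 <= t <= d2 -> h t = h d2 / d2 * t.
  apply: (locally_additive_linear _ _ 4^-1 d20).
    move=> s /andP[s0 sd]; apply/ltW/hs; rewrite ger0_norm//; lra.
  move=> s u s0 u0 su.
  have a1 : `|s| < d by rewrite ger0_norm//; lra.
  have a2 : `|u| < d by rewrite ger0_norm//; lra.
  have a3 : `|s + u| < d by rewrite ger0_norm//; lra.
  apply/eqP; rewrite -subr_eq0; apply/eqP/int_small.
    by apply/mod1_eq; rewrite raddfD /= !hp.
  have := hs _ a1; have := hs _ a2; have := hs _ a3; rewrite !ltr_norml; lra.
exists (h d2 / d2) => t; set c := h d2 / d2.
have phiN s : phi (- s) = - phi s.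
  by apply/eqP; rewrite -subr_eq0 opprK -phiD addNr p00.
wlog t0 : t / 0 <= t.
  move=> H; have [|tn] := leP 0 t; first exact: H.
  by rewrite -[t]opprK phiN H ?mulrN ?raddfN//; lra.
pose n := (Num.truncn (t / d2)).+1.
have nR : (0 : R) < n%:R by rewrite ltr0n.
have tn : t / n%:R <= d2.
  by rewrite ler_pdivrMr// mulrC -ler_pdivrMr// ltW// truncnS_gt.
have tn0 : 0 <= t / n%:R by rewrite divr_ge0// ltW.
have tE : t = (t / n%:R) *+ n by rewrite -mulr_natr divfK// gt_eqF.
have phin m s : phi (s *+ m) = phi s *+ m.
  by elim: m => [|m IH]; rewrite ?mulr0n// !mulrS phiD IH.
rewrite tE phin mulrnAr raddfMn /= -hlin ?tn ?tn0//.
by rewrite hp// ger0_norm//; lra.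
Qed.

(** On each coordinate circle [f] is [mod1 t |-> mod1 (c * t)], and [c] is an
    integer because [mod1 1 = 0]. *)
Lemma torus_char {R : realType} (f : {additive torus R -> circle R}) :
  continuous f ->
  exists k l : int, forall s t,
    f (mod1 s, mod1 t) = mod1 (k%:~R * s + l%:~R * t).
Proof.
move=> cf.
have coord (j : R -> torus R) : {morph j : s t / s + t} -> j 1 = 0 ->
    continuous j -> exists k : int, forall t, f (j t) = mod1 (k%:~R * t).
  move=> jD j1 cj.
  have [||c fc] := @real_char R (f \o j).
  - by move=> s t; rewrite /= jD raddfD.
  - have j0 : j 0 = 0 by apply: (@addrI _ (j 0)); rewrite -jD !addr0.
    have <- : f (j 0) = 0 by rewrite j0 raddf0.
    exact: (continuous_comp (cj 0) (cf (j 0))).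
  have /intrP[k ck] : c \is a Num.int.
    rewrite -[c]mulr1 -[_ * _]subr0; apply/mod1_eq.
    by rewrite -fc /= j1 !raddf0.
  by exists k => t; rewrite -ck -fc.
have mod11 : mod1 (1 : R) = 0.
  by rewrite -(raddf0 mod1); apply/mod1_eq; rewrite subr0.
have [|||k fk] := coord (fun t => (mod1 t, 0)).
- by move=> s t; rewrite raddfD; congr pair; rewrite addr0.
- by rewrite mod11.
- by move=> t; have := cvg_pair (mod1_continuous t)
    (@cvg_cst _ (0 : circle R) _ (nbhs t) _); exact.
have [|||l fl] := coord (fun t => (0, mod1 t)).
- by move=> s t; rewrite raddfD; congr pair; rewrite addr0.
- by rewrite mod11.
- by move=> t; have := cvg_pair (@cvg_cst _ (0 : circle R) _ (nbhs t) _)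
    (mod1_continuous t); exact.
exists k, l => s t; rewrite raddfD /= -fk -fl -raddfD; congr (f _).
by congr pair; rewrite ?addr0 ?add0r.
Qed.

(** * The greedy rearrangement *)

Section greedy.
Context {R : realType} (r : nat -> R).

(** The branches [false] and [true] consist of the terms of even and of odd
    index; below, their terms are eventually nonnegative and nonpositive. *)
Definition branch (b : bool) (n : nat) : R := r (n.*2 + b).

(** The state after [n] steps: the sum of the terms picked so far, and how many
    of them come from each branch.  The next term is taken in the branch [true]
    if this sum is positive, and in the branch [false] otherwise. *)
Fixpoint greedy_state (n : nat) : R * (bool -> nat) :=
  if n is m.+1 then
    let: (t, c) := greedy_state m in
    let b := 0 < t in
    (t + branch b (c b), fun b' => (c b' + (b' == b))%N)
  else (0, fun=> 0%N).

Let total n := (greedy_state n).1.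
Let count b n := (greedy_state n).2 b.
Let choice n := 0 < total n.

Definition greedy (n : nat) : nat := ((count (choice n) n).*2 + choice n)%N.

Let totalS n : total n.+1 = total n + r (greedy n).
Proof.
by rewrite /greedy /choice /count /total /=; case: greedy_state.
Qed.

Let countS b n : count b n.+1 = (count b n + (b == choice n))%N.
Proof. by rewrite /choice /count /total /=; case: greedy_state. Qed.

Lemma series_greedy : series (r \o greedy) = total.
Proof.
apply/funext; elim=> [|n IH]; first by rewrite /series /= big_geq.
by rewrite seriesSr IH totalS.
Qed.

Let total_count n :
  total n = series (branch false) (count false n)
          + series (branch true) (count true n).
Proof.
elim: n => [|n IH]; first by rewrite /series /= !big_geq// addr0.
rewrite totalS !countS IH /greedy -/(branch (choice n) (count (choice n) n)).
by case: (choice n); rewrite /= ?addn0 !addn1 !seriesSr; lra.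
Qed.

Let count_mono b m n : (m <= n)%N -> (count b m <= count b n)%N.
Proof.
elim: n => [|n IH]; first by rewrite leqn0 => /eqP->.
rewrite leq_eqVlt => /predU1P[->//|]; rewrite ltnS => /IH/leq_trans; apply.
by rewrite countS leq_addr.
Qed.

Let count_const b n : (forall m, (n <= m)%N -> choice m = ~~ b) ->
  forall k, count b (n + k) = count b n /\
    count (~~ b) (n + k) = (count (~~ b) n + k)%N.
Proof.
move=> nb; elim=> [|k [IH1 IH2]]; first by rewrite !addn0.
rewrite addnS !countS nb ?leq_addr// eqxx IH1 IH2 addnS addn1.
by case: (b); rewrite addn0.
Qed.

Hypothesis r0 : r @ \oo --> 0.
Hypothesis sgn_branch :
  forall b : bool, \forall n \near \oo, 0 <= (-1) ^+ b * branch b n.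
Hypothesis dvg_branch :
  forall b : bool, series (fun n => (-1) ^+ b * branch b n) @ \oo --> +oo.

(* If one branch were no longer visited, the other would be exhausted in order,
   and its infinite sum would give [total] the sign that calls for the first. *)
Let choice_recurs b n : exists2 m, (n <= m)%N & choice m = b.
Proof.
apply: contrapT => H.
have nb m : (n <= m)%N -> choice m = ~~ b.
  move=> nm; case: (choice m =P b) => [cb|].
    by exfalso; apply: H; exists m.
  by case: (choice m) b {H} => [] [].
have /cvgryPgt/(_ (`|series (branch b) (count b n)|))[N _ HN] :=
  dvg_branch (~~ b).
have := HN (count (~~ b) n + N)%N (leq_addl _ _).
have [c1 c2] := count_const b n nb N.
have := nb (n + N)%N (leq_addr _ _).
have -> : series (fun k => (-1) ^+ (~~ b) * branch (~~ b) k) =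
   (fun k => (-1) ^+ (~~ b) * series (branch (~~ b)) k).
  by apply/funext => k; rewrite /series /= big_distrr.
have := ler_norm (series (branch b) (count b n)).
have := ler_norm (- series (branch b) (count b n)); rewrite normrN.
rewrite /choice total_count; case: (b) c1 c2 => /= -> -> /=;
  rewrite ?expr0 ?expr1 => h1 h2.
  by rewrite ltNge => /negbFE; lra.
by move=> h3; lra.
Qed.

(* The first visit to [b] after step [n] finds the count of [b] as it was at
   step [n], so that every term of the branch is picked. *)
Let count_hit b a : exists2 n, count b n = a & choice n = b.
Proof.
have hit n : exists m, [/\ (n <= m)%N, count b m = count b n & choice m = b].
  have [m] := choice_recurs b n; move: {2}(m - n)%N (erefl (m - n)%N) => k.
  elim: k n => [|k IH] n.
    by move=> mn nm cm; exists m; split=> //; congr count; lia.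
  move=> mn nm cm; have [cn|cn] := eqVneq (choice n) b; first by exists n.
  have [||m' [nm' cm' bm']] := IH n.+1 _ _ cm; [lia|lia|].
  by exists m'; split=> //; [lia|rewrite cm' countS eq_sym (negbTE cn) addn0].
elim: a => [|a [n na nb]]; first by have [m [_ ? ?]] := hit 0%N; exists m.
have [m [_ mc mb]] := hit n.+1; exists m => //.
by rewrite mc countS nb eqxx na addn1.
Qed.

Lemma greedy_bijective : bijective greedy.
Proof.
rewrite -setTT_bijective; split=> //; last first.
- move=> k _; have [n na nb] := count_hit (odd k) k./2; exists n => //.
  by rewrite /greedy nb na addnC odd_double_half.
have lt m n : (m < n)%N -> greedy m <> greedy n.
  move=> mn e; have cmn : choice m = choice n.
    have := congr1 odd e; rewrite /greedy !oddD !odd_double.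
    by case: (choice m); case: (choice n).
  have := count_mono (choice m) m.+1 n mn.
  have := e; rewrite /greedy countS eqxx cmn; lia.
move=> m n _ _ e; have [mn|nm|//] := ltngtP m n; first by case: (lt _ _ mn e).
by case: (lt _ _ nm (esym e)).
Qed.

(** Once the remaining terms are smaller than [e] and have the sign of their
    branch, a step never moves [total] away from 0 except across it, hence by
    less than [e].  Crossings do occur, since both branches are visited
    infinitely often. *)
Lemma greedy_cvg : series (r \o greedy) @ \oo --> 0.
Proof.
rewrite series_greedy; apply/cvgrPdist_lt => e e0.
have /cvgrPdist_lt/(_ e e0)[N0 _ HN0] := r0.
have [N1 _ HN1] := sgn_branch true; have [N2 _ HN2] := sgn_branch false.
pose N := (N0 + N1 + N2)%N.
have [m1 m1N _] := count_hit true N; have [m2 m2N _] := count_hit false N.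
have term n : (m1 + m2 <= n)%N ->
    `|r (greedy n)| < e /\
    (if choice n then r (greedy n) <= 0 else 0 <= r (greedy n)).
  move=> n12.
  have cN : (N <= count (choice n) n)%N.
    by case: (choice n); [rewrite -m1N|rewrite -m2N]; apply: count_mono; lia.
  have := HN0 (greedy n); rewrite /= sub0r normrN; split.
    by apply: H; rewrite /greedy /=; lia.
  rewrite /greedy; case: (choice n) cN => cN.
    by have /= := HN1 (count true n); rewrite expr1 mulN1r oppr_ge0; apply; lia.
  by have /= := HN2 (count false n); rewrite expr0 mul1r; apply; lia.
have stay n : (m1 + m2 <= n)%N -> `|total n| < e -> `|total n.+1| < e.
  move=> /term[]; rewrite totalS /choice !ltr_norml => /andP[h1 h2].
  by case: ltP => h3 h4 /andP[h5 h6]; lra.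
have cross n : (m1 + m2 <= n)%N -> ~~ choice n -> choice n.+1 ->
    `|total n.+1| < e.
  move=> /term[]; rewrite /choice !totalS !ltr_norml => /andP[h1 h2].
  by case: (ltP 0 (total n)) => // h3 h4 _ h5; lra.
have [n1 n1ge n1c] := choice_recurs false (m1 + m2).
have [n2 n2ge n2c] := choice_recurs true n1.
have [n3 n3ge n3e] : exists2 n, (m1 + m2 <= n)%N & `|total n| < e.
  move: {2}(n2 - n1)%N (erefl (n2 - n1)%N) => k.
  elim: k n1 n1ge n1c n2ge => [|k IH] n1 n1ge n1c n2ge kn.
    have nn : n1 = n2 by lia.
    congruence.
  case cn : (choice n1.+1); last by apply: (IH n1.+1) => //; lia.
  by exists n1.+1; [lia|apply: cross; rewrite ?n1c].
exists n3 => // n /= nn; rewrite sub0r normrN -(subnKC nn).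
elim: (n - n3)%N => [|k IH]; first by rewrite addn0.
by rewrite addnS; apply: stay => //; lia.
Qed.

End greedy.

(** * Convergence in the circle and rearrangements on the line *)

Lemma series_mod1 {R : realType} (r : nat -> R) :
  series (mod1 \o r) = mod1 \o series r.
Proof. by apply/funext => n; rewrite /series /= raddf_sum. Qed.

(** Eventually every partial sum lies within 1/4 of [c + Z], where [c] lifts
    [l]; as the terms are smaller than 1/4, it cannot jump from a neighborhood
    of [c + z] to one of [c + z'] with [z' != z], so the integer is constant. *)
Lemma series_bounded_of_cvg_mod1 {R : realType} (r : nat -> R) (l : circle R) :
  r @ \oo --> 0 -> series (mod1 \o r) @ \oo --> l ->
  exists M, \forall n \near \oo, `|series r n| <= M.
Proof.
move=> /cvgrPdist_lt r0; have [c <-] := mod1_surj l => sl.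
have e0 : (0 : R) < 4^-1 by lra.
have [N1 _ HN1] := sl _ (near_mod1 c _ e0).
have [N2 _ HN2] := r0 _ e0.
pose N := (N1 + N2)%N.
have lift n : (N <= n)%N ->
    exists2 y, `|y - c| < 4^-1 & mod1 y = mod1 (series r n).
  by move=> Nn; have := HN1 n; rewrite /= series_mod1; apply; rewrite /=; lia.
have [y yc yN] := lift N (leqnn _).
pose z := series r N - y.
suff H k : exists2 y, `|y - c| < 4^-1 & series r (N + k)%N = y + z.
  exists (`|c| + 4^-1 + `|z|); exists N => // n /= Nn.
  have [y' yc'] := H (n - N)%N; rewrite subnKC// => ->.
  have := ler_normD y' z; have := ler_normD (y' - c) c; rewrite subrK; lra.
elim: k => [|k [u uc uz]]; first by exists y; rewrite // addn0 /z addrC subrK.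
have [v vc vN] := lift (N + k.+1)%N (leq_addr _ _).
exists v => //; apply/eqP; rewrite -subr_eq0; apply/eqP/int_small.
  have zZ : z \is a Num.int by apply/mod1_eq.
  by rewrite opprD addrA rpredB//; apply/mod1_eq.
rewrite addnS seriesSr uz.
have rk : `|r (N + k)%N| < 4^-1.
  by rewrite -normrN -sub0r; apply: HN2 => /=; lia.
by rewrite !ltr_norml in uc vc rk *; lra.
Qed.

Lemma bijective_cvg_infty (s : nat -> nat) : bijective s -> s @ \oo --> \oo.
Proof.
move=> [g gK sK] A [N _ NA].
(* This sum exceeds [g i] for all [i < N]. *)
exists (\sum_(i < N) (g i).+1)%N => // n /= nN; apply: NA; rewrite /= leqNgt.
apply/negP => sn; move: nN; rewrite (bigD1 (Ordinal sn)) //= gK; lia.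
Qed.

Lemma le_series_rearrangement {R : realType} (t : nat -> R) (s : nat -> nat) m :
  (forall n, 0 <= t n) -> bijective s ->
  \forall n \near \oo, series t m <= series (t \o s) n.
Proof.
move=> t0 bs; have [g gK sK] := bs.
(* This sum exceeds [g i] for all [i < m]. *)
exists (\sum_(i < m) (g i).+1)%N => // n /= nN.
have -> : series t m = \sum_(0 <= i < n | (s i < m)%N) t (s i).
  rewrite -big_filter -(big_map s predT t) /series /=; apply: perm_big.
  apply: uniq_perm; rewrite ?iota_uniq//.
    by rewrite map_inj_uniq ?filter_uniq ?iota_uniq//; exact: bij_inj.
  move=> i; rewrite mem_index_iota /=; apply/idP/mapP => [im|[j]].
    exists (g i); rewrite ?sK// mem_filter sK im mem_index_iota /=.
    by move: nN; rewrite (bigD1 (Ordinal im)) //=; lia.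
  by rewrite mem_filter => /andP[+ _] ->.
rewrite /series /= [leRHS](bigID (fun i => (s i < m)%N)) /= lerDl.
by apply: sumr_ge0.
Qed.

Lemma dvg_series_ge {R : realType} (a : R) (w u : nat -> R) : 0 < a ->
  (\forall n \near \oo, a * w n <= u n) ->
  series w @ \oo --> +oo -> series u @ \oo --> +oo.
Proof.
move=> a0 [N _ HN] /cvgryPge w_oo; apply/cvgryPge => B.
have [N' _ HN'] := w_oo ((B + a * series w N - series u N) / a).
have step k : a * series w (N + k)%N - a * series w N <=
    series u (N + k)%N - series u N.
  elim: k => [|k IH]; first by rewrite addn0 !subrr.
  have := HN (N + k)%N (leq_addr _ _).
  by rewrite addnS !seriesSr mulrDr /=; lra.
exists (N + N')%N => // n /= nN.
have := HN' n; rewrite /= ler_pdivrMr// => H; have {H} := H ltac:(lia).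
have := step (n - N)%N; rewrite subnKC; last lia.
by rewrite mulrC; lra.
Qed.

Lemma dvg_series_harmonic {R : realType} : series (@harmonic R) @ \oo --> +oo.
Proof.
apply: nondecreasing_dvgn_lt; last exact: dvg_harmonic.
apply/nondecreasing_seqP => n; rewrite seriesSr lerDl; exact: harmonic_ge0.
Qed.

(** * The sequence *)

Section sequence.
Context {R : realType}.

(** [zigzag n] and [height n] are the [a n] and [t n] of the construction.  Each
    harmonic term is repeated, so that the terms of [zigzag] of index [2 * m] and
    [2 * m + 1] are opposite. *)
Definition height (n : nat) : R := harmonic n./2.
Definition zigzag (n : nat) : R := (-1) ^+ n * Num.sqrt (height n).

Lemma height_ge0 n : 0 <= height n.
Proof. exact: harmonic_ge0. Qed.

Lemma cvg_half : half @ \oo --> \oo.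
Proof.
move=> A [N _ NA]; exists N.*2 => // n /= nN; apply: NA => /=; lia.
Qed.

Lemma height_cvg : height @ \oo --> 0.
Proof. exact: cvg_comp cvg_half cvg_harmonic. Qed.

Lemma sqrt_harmonic_cvg : (fun n => Num.sqrt (harmonic n : R)) @ \oo --> 0.
Proof.
rewrite -[X in _ --> X]sqrtr0; apply: continuous_cvg; last exact: cvg_harmonic.
exact: sqrt_continuous.
Qed.

Lemma zigzag_cvg : zigzag @ \oo --> 0.
Proof.
apply: norm_cvg0; rewrite /zigzag.
have -> : (fun n => `|(-1) ^+ n * Num.sqrt (height n)|) =
  (fun n => Num.sqrt (harmonic n : R)) \o half.
  apply/funext => n /=.
  by rewrite normrM normrX normrN1 expr1n mul1r ger0_norm ?sqrtr_ge0.
exact: cvg_comp cvg_half sqrt_harmonic_cvg.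
Qed.

Lemma dvg_series_height : series height @ \oo --> +oo.
Proof.
apply: (dvg_series_ge 1) dvg_series_harmonic => //; apply: nearW => n.
by rewrite mul1r /height /harmonic /= lef_pV2 ?posrE ?ltr0n// ler_nat; lia.
Qed.

(** With [v = sqrt (harmonic n)], the terms of the two branches are
    [c * v + l * v ^ 2] and [- c * v + l * v ^ 2].  For [c > 0], as [v]
    tends to 0, the former is eventually at least [c / 2 * v], the latter at most
    [- (c / 2 * v)], and both have an infinite sum because [v] is at least the
    harmonic sequence [v ^ 2]. *)
Lemma combination_rearranges (c l : R) : c != 0 ->
  exists2 s : nat -> nat, bijective s &
    series ((fun n => c * zigzag n + l * height n) \o s) @ \oo --> 0.
Proof.
wlog c0 : c l / 0 < c.
  move=> H cN0; have [c0|c0] := leP c 0; last exact: H.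
  have [||s bs /cvgN] := H (- c) (- l); rewrite ?oppr_eq0// ?oppr_gt0.
    by rewrite lt_neqAle cN0.
  rewrite oppr0 => cs; exists s => //; set u := series _.
  suff -> : u = - series ((fun n => - c * zigzag n + - l * height n) \o s).
    by [].
  apply/funext => n; rewrite fctE /u /series /= -sumrN; apply: eq_bigr => i _.
  by rewrite /=; ring.
move=> _; pose r (n : nat) : R := c * zigzag n + l * height n.
have branchE (b : bool) n : (-1) ^+ b * branch r b n =
    c * Num.sqrt (harmonic n) + (-1) ^+ b * l * harmonic n.
  rewrite /branch /r /zigzag /height halfD odd_double /= doubleK.
  have -> : b./2 = 0%N by case: b.
  have -> : (-1) ^+ (n.*2 + b) = (-1) ^+ b :> R.
    by rewrite -signr_odd oddD odd_double /= oddb.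
  rewrite addn0.
  by case: b; rewrite ?expr0 ?expr1 /=; ring.
have branch_ge (b : bool) :
    \forall n \near \oo, c / 2 * harmonic n <= (-1) ^+ b * branch r b n.
  (* For [v] below this bound, [`|l| * v <= c / 2]. *)
  have e0 : 0 < c / 2 / (`|l| + 1).
    by rewrite !divr_gt0//; have := normr_ge0 l; lra.
  have /cvgrPdist_lt/(_ _ e0) := sqrt_harmonic_cvg.
  apply: filterS => n; rewrite branchE sub0r normrN ger0_norm ?sqrtr_ge0//.
  rewrite ltr_pdivlMr; last by have := normr_ge0 l; lra.
  have := sqr_sqrtr (harmonic_ge0 n : 0 <= harmonic n :> R).
  have := sqrtr_ge0 (harmonic n : R).
  have : Num.sqrt (harmonic n : R) <= 1.
    by rewrite -sqrtr1 ler_sqrt// /harmonic /= invf_le1 ?ltr0n// ler1n.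
  move: (Num.sqrt _) => v v1 v0 <- vc.
  have -> : (-1) ^+ b * l * v ^+ 2 = ((-1) ^+ b * l * v) * v by ring.
  have : `|(-1) ^+ b * l * v| <= c / 2.
    by rewrite !normrM normrX normrN1 expr1n mul1r (ger0_norm v0); nra.
  rewrite ler_norml; move: (_ * l * v) => w /andP[w1 _].
  have : 0 <= (w + c / 2) * v by rewrite mulr_ge0//; lra.
  have : 0 <= c / 2 * (v * (1 - v)) by rewrite !mulr_ge0//; lra.
  by rewrite expr2; lra.
have r0 : r @ \oo --> 0.
  rewrite -[X in _ --> X](_ : c * 0 + l * 0 = 0); last by rewrite !mulr0 addr0.
  by apply: cvgD; apply: cvgMr; [exact: zigzag_cvg|exact: height_cvg].
have sgn (b : bool) : \forall n \near \oo, 0 <= (-1) ^+ b * branch r b n.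
  apply: filterS (branch_ge b) => n; apply: le_trans.
  by rewrite mulr_ge0 ?harmonic_ge0// divr_ge0// ltW.
have dvg (b : bool) : series (fun n => (-1) ^+ b * branch r b n) @ \oo --> +oo.
  by apply: (dvg_series_ge (c / 2)) dvg_series_harmonic => //; rewrite divr_gt0.
by exists (greedy r); [exact: greedy_bijective|exact: greedy_cvg].
Qed.

End sequence.

Lemma series_pair {U V : zmodType} (x : nat -> U * V) n :
  series x n = (series (fst \o x) n, series (snd \o x) n).
Proof. by rewrite [LHS]surjective_pairing /series /= !raddf_sum. Qed.

Theorem mainTheorem2 (R : realType) :
  exists x : nat -> torus R,
    [/\ x @ \oo --> (0 : torus R),
        forall f : {additive torus R -> circle R},
          continuous f -> potentially_convergent (f \o x)
      & ~ potentially_convergent x].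
Proof.
have [theta theta_irr] : exists theta : R, ~ rational theta.
  by exists pi; exact: pi_irrationnal.
pose y n : R := theta * zigzag n + height n.
have y0 : y @ \oo --> 0.
  rewrite -[X in _ --> X](_ : theta * 0 + 0 = 0); last by rewrite mulr0 addr0.
  by apply: cvgD; [apply: cvgMr; exact: zigzag_cvg|exact: height_cvg].
have mod1_cvg (u : nat -> R) l : u @ \oo --> l -> (mod1 \o u) @ \oo --> mod1 l.
  by move=> ul; exact: (continuous_cvg _ (mod1_continuous l) ul).
exists (fun n => (mod1 (zigzag n), mod1 (y n))); split.
- have := cvg_pair (mod1_cvg _ _ zigzag_cvg) (mod1_cvg _ _ y0).
  by rewrite !raddf0; exact.
- move=> f /torus_char[k [l fkl]].
  pose c := k%:~R + l%:~R * theta.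
  have fx : f \o (fun n => (mod1 (zigzag n), mod1 (y n))) =
      mod1 \o (fun n => c * zigzag n + l%:~R * height n).
    by apply/funext => n /=; rewrite fkl /y /c; congr mod1; ring.
  rewrite fx; have [c0|cN0] := eqVneq c 0.
    have l0 : l = 0.
      apply/eqP/negPn/negP => lN0; apply: theta_irr.
      have lR : l%:~R != 0 :> R by rewrite intr_eq0.
      exists (- k%:~R / l%:~R) => //; rewrite fmorph_div rmorphN /= !ratr_int.
      by apply: (mulIf lR); rewrite divfK//; move: c0; rewrite /c; lra.
    exists id, 0; split; first by exists id.
    rewrite (_ : series _ = cst 0); first exact: cvg_cst.
    apply/funext => n; rewrite /series /=; apply: big1 => i _.
    by rewrite c0 l0 !mul0r addr0 raddf0.
  have [s bs sc] := combination_rearranges c l%:~R cN0.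
  exists s, 0; split=> //.
  have := mod1_cvg _ _ sc; rewrite raddf0 -series_mod1; exact.
case=> s [[l1 l2] [bs]] sl.
have [s1 s2] : series (mod1 \o (zigzag \o s)) @ \oo --> l1 /\
    series (mod1 \o (y \o s)) @ \oo --> l2.
  rewrite (_ : series _ = (fun n => (series (mod1 \o (zigzag \o s)) n,
      series (mod1 \o (y \o s)) n) : torus R)) in sl; last first.
    by apply/funext => n; exact: series_pair.
  split; [exact: (cvg_comp _ _ sl (@cvg_fst (circle R) (circle R) _ _ _))|].
  exact: (cvg_comp _ _ sl (@cvg_snd (circle R) (circle R) _ _ _)).
have soo := bijective_cvg_infty s bs.
have [M1 HM1] :=
  series_bounded_of_cvg_mod1 _ _ (cvg_comp _ _ soo zigzag_cvg) s1.
have [M2 HM2] := series_bounded_of_cvg_mod1 _ _ (cvg_comp _ _ soo y0) s2.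
pose M := `|theta| * M1 + M2.
have Hs : \forall n \near \oo, series (height \o s) n <= M.
  apply: filterS2 HM1 HM2 => n z1 z2.
  have -> : series (height \o s) n =
      series (y \o s) n - theta * series (zigzag \o s) n.
    rewrite /series /= mulr_sumr -sumrB; apply: eq_bigr => i _.
    by rewrite /y /=; ring.
  apply: le_trans (ler_norm _) _; apply: le_trans (ler_normB _ _) _.
  by rewrite addrC normrM lerD// ler_wpM2l.
have /cvgryPgt/(_ M)[m _ Hm] := dvg_series_height (R := R).
have Mm : M < series (@height R) m by apply: Hm => /=.
have [N1 _ HN1] := Hs.
have [N2 _ HN2] := le_series_rearrangement (@height R) s m height_ge0 bs.
have := le_trans (HN2 (N1 + N2)%N (leq_addl _ _)) (HN1 _ (leq_addr _ _)).
by rewrite leNgt Mm.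
Qed.
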